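(* Let $M:(0,\infty)^2\to(0,\infty)$ be a mean and let $r$ be a real function defined on $(0,\infty)$ with $\lim_{x\to\infty}r(x)=0$. Then for fixed real numbers $\theta,\sigma$ (and $x>-\min(1,\theta,\sigma)$), the asymptotic formula for the psi function $\psi(x+1)\sim\ln M(x+\theta,x+\sigma)+r(x)$ holds as $x\to\infty$, in the sense that $$\lim_{x\to\infty}\Bigl(\psi(x+1)-\ln M(x+\theta,x+\sigma)-r(x)\Bigr)=0.$$
   Context: $\psi=\Gamma'/\Gamma$ is the psi (digamma) function, where $\Gamma$ is Euler's gamma function. For an interval $I\subseteq\mathbb{R}$, a function $M:I^2\to\mathbb{R}$ is a (bivariate) mean if $\min(a,b)\le M(a,b)\le\max(a,b)$ for all $a,b\in I$. *)

(* Defs.v *)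
From mathcomp Require Import all_boot all_order all_algebra.
From mathcomp Require Import all_classical all_reals all_analysis.

Set Implicit Arguments.
Unset Strict Implicit.
Unset Printing Implicit Defensive.

Import Order.TTheory GRing.Theory Num.Theory.
Import numFieldNormedType.Exports.

Local Open Scope classical_set_scope.
Local Open Scope ring_scope.

(* Euler's integral of the second kind. The value is meaningful only for
   x > 0: otherwise the integral diverges and [Rintegral] returns 0. *)
Definition Gamma {R : realType} (x : R) : R :=
  \int[@lebesgue_measure R]_(t in `]0, +oo[) (t `^ (x - 1) * expR (- t)).

Definition psi {R : realType} (x : R) : R := derive1 Gamma x / Gamma x.

(* M is total; its values outside I x I are unconstrained. *)
Definition is_mean {R : realType} (I : interval R) (M : R -> R -> R) : Prop :=
  forall a b : R, a \in I -> b \in I ->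
    Num.min a b <= M a b <= Num.max a b.

(* Main.v *)
(* Differentiating under the integral sign, Gamma' (x + 1) is the integral of
   ln t * t^x e^-t. As ln lies below its tangents, ln t <= ln c + t/c - 1 and
   ln t >= ln c + 1 - c/t; integrating the former with c = x + 1 and the latter
   with c = x, and using Gamma (a + 1) = a Gamma a, gives
   ln x <= psi (x + 1) <= ln (x + 1). Since M (x + theta) (x + sigma) lies
   between two translates of x, its logarithm also differs from ln x by O(1/x). *)
Require Import Defs.
From mathcomp Require Import all_boot all_order all_algebra.
From mathcomp Require Import all_classical all_reals all_analysis.
From mathcomp Require Import measurable_realfun ring lra.
Import Order.TTheory GRing.Theory Num.Theory.
Import numFieldNormedType.Exports.
Local Open Scope classical_set_scope.
Local Open Scope ring_scope.

(** * Elementary bounds on the logarithm and on the gamma integrand *)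

(** This is [ln (1 + u) <= u] at [u = t / c - 1]. Exchanging [c] and [t] turns it into the lower
    bound [ln c + 1 - c / t <= ln t]. *)
Lemma ln_le_tangent {R : realType} (c t : R) : 0 < c -> 0 < t ->
  ln t <= ln c + t / c - 1.
Proof.
move=> c0 t0; have tc0 : 0 < t / c by rewrite divr_gt0.
have : ln (1 + (t / c - 1)) <= t / c - 1 by apply: le_ln1Dx; lra.
by rewrite addrCA subrr addr0 ln_div ?posrE//; lra.
Qed.

(** Trades the logarithm for powers: [|ln t| * t^a] is dominated by [t^(a + 1) + t^(a - 1)]. *)
Lemma norm_ln_le {R : realType} (t : R) : 0 < t -> `|ln t| <= t + t^-1.
Proof.
move=> t0; have := ln_le_tangent _ _ ltr01 t0.
have := ln_le_tangent _ _ t0 ltr01.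
have : 0 < t^-1 by rewrite invr_gt0.
by rewrite ln1 mul1r divr1 ler_norml; lra.
Qed.

(** Half of the decay of [expR (- t)] absorbs the power, by the tangent bound on [ln t]. *)
Lemma powR_expRN_le {R : realType} (a : R) : 0 <= a ->
  exists2 K : R, 0 <= K &
    forall t : R, 0 < t -> t `^ a * expR (- t) <= K * expR (- 2^-1 * t).
Proof.
(* This choice gives [a / c <= 2^-1] and keeps [c] positive even for [a = 0]; the witness for [K] is
   then [c^a]. *)
move=> a0; pose c := 2 * a + 1; have c0 : 0 < c by rewrite /c; lra.
exists (expR (a * ln c)); first exact: expR_ge0.
move=> t t0; rewrite /powR gt_eqF// -!expRD ler_expR.
have := ler_wpM2l a0 (ln_le_tangent _ _ c0 t0).
have : a * (t / c) <= 2^-1 * t.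
  rewrite mulrA ler_pdivrMr//; have := mulr_ge0 a0 (ltW t0); rewrite /c; nra.
by nra.
Qed.

Section gamma.
Context {R : realType}.
Notation mu := (@lebesgue_measure R).
Implicit Types a t x : R.

(** * Integrals over the half-line and the functional equation of gamma *)

Lemma cvgr_expRMl (k : R) : k < 0 -> expR (k * t) @[t --> +oo] --> (0 : R).
Proof.
move=> k0; rewrite (_ : (fun t => expR (k * t)) =
    (fun z => expR (- z)) \o ( *%R (- k))); last first.
  by apply: eq_fun => t; rewrite mulNr opprK.
apply: (@cvg_comp _ _ _ _ _ _ (pinfty_nbhs R)); last exact: cvgr_expR.
by apply: gt0_cvgMry => //; rewrite oppr_gt0.
Qed.

Lemma continuous_expRMl (k : R) : continuous (fun t : R => expR (k * t)).
Proof.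
move=> t; apply: differentiable_continuous; apply/derivable1_diffP.
exact: ex_derive.
Qed.

Lemma integral_expRMl (k : R) : k < 0 ->
  (\int[mu]_(t in `[0%R, +oo[) (expR (k * t))%:E = (- k^-1)%:E)%E.
Proof.
move=> k0; have kn0 : k != 0 by rewrite lt_eqF.
have dF (t : R) : is_derive t (1 : R) (fun s => k^-1 * expR (k * s))
    (expR (k * t)).
  by apply: is_derive_eq; rewrite [k%:A]mulr1 [expR _ * _]mulrC [LHS]mulKf.
rewrite (@ge0_continuous_FTC2y _ _ (fun t => k^-1 * expR (k * t)) _ 0)//.
- by rewrite mulr0 expR0 mulr1 -EFinB sub0r.
- by apply: continuous_subspaceT; exact: continuous_expRMl.
- by rewrite -[0](mulr0 k^-1); apply: cvgMl_tmp; exact: cvgr_expRMl.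
- by apply: cvg_at_right_filter; apply: cvgMl_tmp; exact: continuous_expRMl.
- by move=> t _; rewrite derive1E derive_val.
Qed.

Lemma integrable_expRMl (k : R) : k < 0 ->
  mu.-integrable `]0, +oo[ (EFin \o (fun t => expR (k * t))).
Proof.
move=> k0; apply: (@integrableS _ _ _ mu `[0, +oo[) => //.
  by apply: subset_itvr; rewrite bnd_simp.
apply/integrableP; split.
  apply/measurable_EFinP/measurable_funTS.
  by apply: continuous_measurable_fun; exact: continuous_expRMl.
under eq_integral do rewrite /= ger0_norm ?expR_ge0//.
by rewrite integral_expRMl// ltry.
Qed.


Lemma measurable_powR_expRN a (D : set R) : measurable D ->
  measurable_fun D (fun t => t `^ a * expR (- t)).
Proof.
move=> mD; apply: measurable_funTS; apply: measurable_funM.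
  exact: measurable_powR.
apply: continuous_measurable_fun => t.
apply: continuous_comp; [exact: opp_continuous|exact: continuous_expR].
Qed.

Lemma integrable_powR_expRN a : 0 <= a ->
  mu.-integrable `]0, +oo[ (EFin \o (fun t => t `^ a * expR (- t))).
Proof.
move=> /powR_expRN_le[K K0 le_K].
have h0 : - (2^-1 : R) < 0 by lra.
apply: (le_integrable _ _ _ (integrableZl _ K (integrable_expRMl _ h0))) => //.
  by apply/measurable_EFinP; exact: measurable_powR_expRN.
move=> t /=; rewrite in_itv/= andbT => t0.
rewrite lee_fin !ger0_norm ?mulr_ge0 ?powR_ge0 ?expR_ge0//; exact: le_K.
Qed.

Lemma integrable_ln_powR_expRN a : 1 <= a ->
  mu.-integrable `]0, +oo[ (EFin \o (fun t => ln t * (t `^ a * expR (- t)))).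
Proof.
move=> a1; have ap : 0 <= a + 1 by lra.
have am : 0 <= a - 1 by lra.
apply: (le_integrable _ _ _ (integrableD _
  (integrable_powR_expRN _ ap) (integrable_powR_expRN _ am))) => //.
  apply/measurable_EFinP; apply: measurable_funM.
    by apply: measurable_funTS; exact: measurable_ln.
  exact: measurable_powR_expRN.
move=> t /=; rewrite in_itv/= andbT => t0.
rewrite lee_fin normrM [X in _ * X]ger0_norm ?mulr_ge0 ?powR_ge0 ?expR_ge0//.
rewrite [leRHS]ger0_norm ?addr_ge0 ?mulr_ge0 ?powR_ge0 ?expR_ge0//.
rewrite -mulrDl mulrA ler_wpM2r ?expR_ge0// powRD ?(gt_eqF t0) ?implybT//.
rewrite powRB ?(gt_eqF t0) ?implybT// powRr1 ?(ltW t0)//.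
rewrite [t `^ a * t]mulrC [_ / t]mulrC.
by rewrite -mulrDl ler_wpM2r ?powR_ge0// norm_ln_le.
Qed.

Lemma continuous_powR_expRN a : 0 < a ->
  {within `[0, +oo[, continuous (fun t : R => t `^ a * expR (- t))}.
Proof.
move=> a0; apply/continuous_within_itvcyP; split.
  move=> t; rewrite in_itv/= andbT => t0; rewrite /continuous_at; apply: cvgM.
    have : {for t, continuous (@powR R ^~ a)}.
      apply: differentiable_continuous; apply/derivable1_diffP.
      by apply: derivable_powR; rewrite in_itv/= andbT.
    exact.
  by apply: continuous_comp; [exact: opp_continuous|exact: continuous_expR].
apply: cvgM.
  by rewrite powR0 ?gt_eqF//; exact: powR_cvg0.
apply: cvg_at_right_filter.
by apply: continuous_comp; [exact: opp_continuous|exact: continuous_expR].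
Qed.

Lemma cvgr_powR_expRN a : 0 <= a ->
  t `^ a * expR (- t) @[t --> +oo] --> (0 : R).
Proof.
move=> /powR_expRN_le[K K0 le_K].
have h0 : - (2^-1 : R) < 0 by lra.
have cvgK : K * expR (- 2^-1 * t) @[t --> +oo] --> (0 : R).
  by rewrite -[0](mulr0 K); apply: cvgMl_tmp; exact: cvgr_expRMl.
apply: (squeeze_cvgr _ (cvg_cst 0) cvgK).
near=> t; rewrite mulr_ge0 ?powR_ge0 ?expR_ge0//=; apply: le_K.
by near: t; exact: nbhs_pinfty_gt.
Unshelve. end_near. Qed.

(* The primitive [t^x e^-t] of [x t^(x-1) e^-t - t^x e^-t] is corrected by a
   multiple of [e^(-t/2)] that makes the integrand nonnegative, as required by
   the fundamental theorem of calculus on a half-line. *)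
Lemma GammaD1 x : 1 < x -> Gamma (x + 1) = x * Gamma x.
Proof.
move=> x1; have x0 : 0 <= x by lra.
have xB0 : 0 <= x - 1 by lra.
have [K K0 le_K] := powR_expRN_le _ x0.
have h0 : - (2^-1 : R) < 0 by lra.
pose A t := t `^ (x - 1) * expR (- t).
pose B t := t `^ x * expR (- t).
pose C t := expR (- 2^-1 * t).
have iA : mu.-integrable `]0, +oo[ (EFin \o A) by exact: integrable_powR_expRN.
have iB : mu.-integrable `]0, +oo[ (EFin \o B) by exact: integrable_powR_expRN.
have iC : mu.-integrable `]0, +oo[ (EFin \o C) by exact: integrable_expRMl.
have ixA : mu.-integrable `]0, +oo[ (EFin \o (fun t => x * A t)).
  exact: (integrableZl _ x iA).
have iKC : mu.-integrable `]0, +oo[ (EFin \o (fun t => K * C t)).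
  exact: (integrableZl _ K iC).
have iAB : mu.-integrable `]0, +oo[ (EFin \o (fun t => x * A t - B t)).
  exact: (integrableB _ ixA iB).
have iABC : mu.-integrable `]0, +oo[ (EFin \o (fun t => x * A t - B t + K * C t)).
  exact: (integrableD _ iAB iKC).
(* The term [- 2 * K * C t] has derivative [K * C t], which dominates [B t] for [t > 0] by
   [le_K]. *)
pose F t := B t - 2 * K * C t.
have B0 : B 0 = 0 by rewrite /B powR0 ?mul0r// gt_eqF//; lra.
have F0 : F 0 = - (2 * K) by rewrite /F B0 /C mulr0 expR0; lra.
have dF t : 0 < t -> is_derive t (1 : R) F (x * A t - B t + K * C t).
  move=> t0; have dpow := is_derive1_powR x t0.
  have dexp (k : R) : is_derive t (1 : R) (fun s => expR (k * s))
      (k * expR (k * t)).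
    by apply: is_derive_eq; rewrite [k%:A]mulr1 mulrC.
  have -> : F = ((@powR R ^~ x) * (fun s => expR (- 1 * s)) - (2 * K) \*: C).
    by apply/funext => s; rewrite /F /B -[- s]mulN1r.
  by apply: is_derive_eq; rewrite /GRing.scale/= mulN1r /A /B /C; field.
have intF : \int[mu]_(t in `[0, +oo[) (x * A t - B t + K * C t) = 0 - F 0.
  apply: Rintegral_ge0_continuous_FTC2y.
  - move=> t; rewrite le_eqVlt => /predU1P[<-|t0].
      by rewrite B0 subr0 addr_ge0 ?mulr_ge0 ?powR_ge0 ?expR_ge0.
    have := le_K _ t0; rewrite -/(B t) -/(C t).
    have : 0 <= x * A t by rewrite !mulr_ge0 ?powR_ge0 ?expR_ge0.
    lra.
  - move=> t; apply: cvgD; [apply: cvgB; [apply: cvgMl_tmp|]|apply: cvgMl_tmp].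
    + by apply: (continuous_powR_expRN (x - 1)); lra.
    + by apply: (continuous_powR_expRN x); lra.
    + by apply: continuous_subspaceT; exact: continuous_expRMl.
  - rewrite -[0](subr0 0) -[X in _ --> 0 - X](mulr0 (2 * K)).
    apply: cvgB; first exact: cvgr_powR_expRN.
    by apply: cvgMl_tmp; exact: cvgr_expRMl.
  - by move=> t t0; have [] := dF _ t0.
  - apply: cvgB; last first.
      by apply: cvg_at_right_filter; apply: cvgMl_tmp; exact: continuous_expRMl.
    have /continuous_within_itvcyP[_] := @continuous_powR_expRN x ltac:(lra).
    exact.
  - by move=> t; rewrite in_itv/= andbT derive1E => /dF[].
have intC : \int[mu]_(t in `]0, +oo[) C t = 2.
  rewrite Rintegral_itv_obnd_cbnd// /Rintegral integral_expRMl//=.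
  by rewrite invrN invrK opprK.
(* The correction cancels: [K * C t] integrates to [2 * K], which is also [- F 0]. *)
have := intF; rewrite F0 -Rintegral_itv_obnd_cbnd// RintegralD// RintegralB//.
rewrite !RintegralZl// intC => H.
have -> : Gamma (x + 1) = \int[mu]_(t in `]0, +oo[) B t.
  by rewrite /Gamma; under eq_Rintegral do rewrite addrK.
rewrite /Gamma -/A; lra.
Qed.

(** * The derivative of gamma *)

(** The power decreases in its exponent for [t <= 1] and increases for [t > 1], so one endpoint
    always dominates. Adding both yields a bound uniform in [s], as domination under the integral
    sign demands. *)
Lemma powR_le_endpoints (a b s t : R) : 0 < t -> a <= s -> s <= b ->
  t `^ s <= t `^ a + t `^ b.
Proof.
move=> t0 as_ sb; have [t1|t1] := leP t 1.
  by rewrite ler_wpDr ?powR_ge0// ger_powR ?t0.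
by rewrite ler_wpDl ?powR_ge0// ler_powR// ltW.
Qed.

Lemma is_derive_powRr t x : 0 < t ->
  is_derive x (1 : R) (fun s => t `^ s) (ln t * t `^ x).
Proof.
move=> t0; have -> : (fun s => t `^ s) = (fun s => expR (ln t * s)).
  by apply/funext => s; rewrite /powR gt_eqF// mulrC.
rewrite /powR gt_eqF// [x * _]mulrC; apply: is_derive_eq.
by rewrite [X in _ * X = _]mulr1; exact: mulrC.
Qed.

(** Dominated differentiation on the neighbourhood []2, x + 1[] of [x]. There [s - 1] stays above 1,
    so even after the factor [t^-1] from [norm_ln_le] no negative power of [t] occurs, and one
    multiple of [expR (- 2^-1 * t)] dominates. *)
Lemma derive1_Gamma x : 2 < x ->
  derive1 Gamma x =
    \int[mu]_(t in `]0, +oo[) (ln t * (t `^ (x - 1) * expR (- t))).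
Proof.
move=> x2.
pose f s t : R := t `^ (s - 1) * expR (- t).
have df s t : 0 < t -> is_derive s (1 : R) (f ^~ t) (ln t * f s t).
  move=> t0.
  have dp := is_derive_powRr t (s - 1) t0.
  have -> : (f ^~ t) = (fun u => expR (- t) * (t `^ u)) \o (fun s => s - 1).
    by apply/funext => u; rewrite /f mulrC.
  by apply: is_derive_eq; rewrite /GRing.scale/= /f; ring.
have d1f s t : 0 < t -> partial1of2 f s t = ln t * f s t.
  by move=> t0; rewrite partial1of2E; case: (df s t t0).
pose I : set R := `]2, x + 1[%classic.
have h0 : - (2^-1 : R) < 0 by lra.
have [K K0 le_K] : exists2 K : R, 0 <= K & forall s t : R, I s -> 0 < t ->
    `|ln t * f s t| <= K * expR (- 2^-1 * t).
  (* Bounding [ln t] by [t + t^-1] and [t^(s - 1)] by [t^1 + t^x] leaves the powers [t^2],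
     [t^(x + 1)], [t^0] and [t^(x - 1)], each with its own constant. *)
  have [|K1 K10 le_K1] := @powR_expRN_le R 2; first lra.
  have [|K2 K20 le_K2] := @powR_expRN_le R (x + 1); first lra.
  have [|K3 K30 le_K3] := @powR_expRN_le R 0; first lra.
  have [|K4 K40 le_K4] := @powR_expRN_le R (x - 1); first lra.
  exists (K1 + K2 + (K3 + K4)); first by rewrite !addr_ge0.
  move=> s t; rewrite /I/= in_itv/= => /andP[s2 sx] t0.
  rewrite normrM [X in _ * X]ger0_norm ?mulr_ge0 ?powR_ge0 ?expR_ge0//.
  have tV0 : 0 < t^-1 by rewrite invr_gt0.
  apply: (@le_trans _ _ ((t + t^-1) * ((t `^ 1 + t `^ x) * expR (- t)))).
    apply: ler_pM; rewrite ?mulr_ge0 ?powR_ge0 ?expR_ge0 ?norm_ln_le//.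
    by rewrite ler_wpM2r ?expR_ge0//; apply: powR_le_endpoints => //; lra.
  have tn0 : t != 0 by rewrite gt_eqF.
  rewrite mulrA !mulrDl !mulrDr.
  have := le_K1 _ t0; have := le_K2 _ t0; have := le_K3 _ t0; have := le_K4 _ t0.
  have -> : t `^ 2 = t * t `^ 1.
    by rewrite powRr1 ?ltW// -expr2 -powR_mulrn// ltW.
  have -> : t `^ (x + 1) = t * t `^ x.
    by rewrite powRD ?tn0 ?implybT// powRr1 ?ltW// mulrC.
  have -> : t `^ 0 = t^-1 * t `^ 1 by rewrite powRr0 powRr1 ?ltW// mulVf.
  have -> : t `^ (x - 1) = t^-1 * t `^ x.
    by rewrite powRB ?tn0 ?implybT// powRr1 ?ltW// mulrC.
  lra.
have -> : Gamma = fun s => \int[mu]_(t in `]0, +oo[) f s t by [].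
rewrite (@differentiation_under_integral _ _ _ mu f `]0, +oo[ _ x 2 (x + 1) _ _ _
  (fun t => K * expR (- 2^-1 * t))) //=.
- by apply: eq_Rintegral => t; rewrite inE/= in_itv/= andbT => /(d1f x t).
- by rewrite in_itv/=; apply/andP; split; lra.
- move=> s; rewrite in_itv/= => /andP[s2 _].
  by apply: integrable_powR_expRN; lra.
- by move=> s t _; rewrite in_itv/= andbT => /(df s t)[].
- by move=> t; rewrite mulr_ge0 ?expR_ge0.
- exact: (integrableZl _ K (integrable_expRMl _ h0)).
- move=> s t Is; rewrite in_itv/= andbT => t0.
  by rewrite d1f//; exact: le_K.
Qed.

(** * Positivity of gamma and logarithmic bounds on psi *)

(** The integrand is nonnegative, and on [[1, 2]] it is at least [expR (- 2)] because
    [t^(x - 1) >= 1] there. *)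
Lemma Gamma_gt0 x : 1 <= x -> 0 < Gamma x.
Proof.
move=> x1.
have x0 : 0 <= x - 1 by lra.
have iG := integrable_powR_expRN _ x0.
have le_G : ((expR (- 2))%:E <=
    \int[mu]_(t in `]0%R, +oo[) (t `^ (x - 1) * expR (- t))%:E)%E.
  apply: (@le_trans _ _ (\int[mu]_(t in `[1%R, 2%R]) (expR (- 2))%:E)%E).
    by rewrite integral_cst//= lebesgue_measure_itv/= lte_fin ifT ?ltr1n// -EFinB
      (_ : 2 - 1 = 1) ?mule1//; lra.
  apply: (@le_trans _ _ (\int[mu]_(t in `[1%R, 2%R])
      (t `^ (x - 1) * expR (- t))%:E)%E).
    apply: ge0_le_integral => //.
    - by apply/measurable_EFinP; exact: measurable_powR_expRN.
    - move=> t /=; rewrite in_itv/= => /andP[t1 t2].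
      rewrite lee_fin -[leLHS]mul1r ler_pM ?expR_ge0 ?ler_expR ?lerN2//.
      by rewrite -[leLHS](powRr0 t) ler_powR.
  apply: ge0_subset_integral => //.
  - by apply/measurable_EFinP; exact: measurable_powR_expRN.
  - by move=> t _; rewrite lee_fin mulr_ge0 ?powR_ge0 ?expR_ge0.
  - move=> t /=; rewrite !in_itv/= => /andP[t1 _].
    by rewrite andbT (lt_le_trans _ t1).
(* Integrability matters here: [fine] would send an infinite integral to 0. *)
rewrite (lt_le_trans (expR_gt0 (- 2)))// -lee_fin /Gamma/Rintegral fineK//.
exact: integrable_fin_num.
Qed.

(** [psi (x + 1)] is the average of [ln t] for the weight [t^x e^-t]. The average of [t] is [x + 1]
    and that of [1 / t] is [1 / x], which singles out the two points of tangency. *)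
Lemma psiD1_bounds x : 1 < x -> ln x <= psi (x + 1) <= ln (x + 1).
Proof.
move=> x1; have x0 : 0 < x by lra.
have xD0 : 0 < x + 1 by lra.
have G1 : 0 < Gamma (x + 1) by apply: Gamma_gt0; lra.
have a0 : 0 <= x by lra.
have a1 : 1 <= x by lra.
have b0 : 0 <= x - 1 by lra.
have c0 : 0 <= x + 1 by lra.
pose w a t : R := t `^ a * expR (- t).
have w_ge0 a t : 0 <= w a t by rewrite mulr_ge0 ?powR_ge0 ?expR_ge0.
have iw a : 0 <= a -> mu.-integrable `]0, +oo[ (EFin \o w a).
  exact: integrable_powR_expRN.
have iZw c a : 0 <= a -> mu.-integrable `]0, +oo[ (EFin \o (fun t => c * w a t)).
  by move=> /iw iwa; exact: (integrableZl _ c iwa).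
have wE a : \int[mu]_(t in `]0, +oo[) w a t = Gamma (a + 1).
  by rewrite /Gamma; under [RHS]eq_Rintegral do rewrite addrK.
have iln : mu.-integrable `]0, +oo[ (EFin \o (fun t => ln t * w x t)).
  exact: integrable_ln_powR_expRN.
rewrite /psi derive1_Gamma; last lra.
under eq_Rintegral do rewrite addrK.
rewrite ler_pdivlMr// ler_pdivrMr//; apply/andP; split.
(* The integral on the right is [(ln x + 1) * Gamma (x + 1) - x * Gamma x], and the functional
   equation cancels the surplus. Its integrand is [ln x + 1 - x / t] times [w x t], with the
   division by [t] absorbed into [w (x - 1) t]. *)
- have -> : ln x * Gamma (x + 1) =
      \int[mu]_(t in `]0, +oo[) ((ln x + 1) * w x t - x * w (x - 1) t).
    rewrite RintegralB ?RintegralZl ?wE ?subrK ?GammaD1//;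
      [|exact: iw|exact: iw|exact: iZw|exact: iZw].
    by ring.
  apply: le_Rintegral => //.
    exact: (integrableB _ (iZw (ln x + 1) x a0) (iZw x (x - 1) b0)).
  move=> t /=; rewrite in_itv/= andbT => t0.
  have le_ln := ln_le_tangent _ _ t0 x0.
  rewrite -/(w x t).
  have -> : w x t = t * w (x - 1) t by rewrite /w mulrA mulr_powRB1// ltW.
  have : 0 <= (ln t + x / t - 1 - ln x) * (t * w (x - 1) t).
    by apply: mulr_ge0; [lra|exact: mulr_ge0 (ltW t0) (w_ge0 _ _)].
  rewrite (_ : _ * (t * _) = ln t * (t * w (x - 1) t) -
    (ln x + 1) * (t * w (x - 1) t) + x * w (x - 1) t); first lra.
  by field; rewrite gt_eqF.
- have xD1 : 1 < x + 1 by lra.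
  (* Here the functional equation at [x + 1] makes the last term integrate to [Gamma (x + 1)], which
     offsets the [- 1]. *)
  have -> : ln (x + 1) * Gamma (x + 1) = \int[mu]_(t in `]0, +oo[)
      ((ln (x + 1) - 1) * w x t + (x + 1)^-1 * w (x + 1) t).
    rewrite RintegralD ?RintegralZl ?wE// ?(GammaD1 (x + 1))//;
      [|exact: iw|exact: iw|exact: iZw|exact: iZw].
    by field; rewrite gt_eqF.
  apply: le_Rintegral => //.
    exact: (integrableD _ (iZw (ln (x + 1) - 1) x a0) (iZw (x + 1)^-1 (x + 1) c0)).
  move=> t /=; rewrite in_itv/= andbT => t0.
  rewrite -/(w x t).
  have -> : w (x + 1) t = t * w x t.
    by rewrite /w mulrA -[in RHS](addrK 1 x) mulr_powRB1// ltW.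
  have := ler_wpM2r (w_ge0 x t) (ln_le_tangent _ _ xD0 t0); lra.
Qed.

(** * Asymptotic comparison with the logarithm of the mean *)

Lemma cvgr_div_shift (c d : R) : c / (x + d) @[x --> +oo] --> (0 : R).
Proof.
rewrite -[0](mulr0 c); apply: cvgMl_tmp.
apply/(@gtr0_cvgV0 _ _ _ _ (fun x => x + d)); last exact: cvg_addrr.
near=> x; rewrite -ltrBlDr; near: x; apply: nbhs_pinfty_gt; exact: num_real.
Unshelve. end_near. Qed.

End gamma.

Theorem theorem4 (R : realType) (M : R -> R -> R) (r : R -> R) (theta sigma : R)
  (M_pos : forall a b : R, 0 < a -> 0 < b -> 0 < M a b)
  (M_mean : is_mean `]0, +oo[ M)
  (r_lim : r x @[x --> +oo] --> (0 : R)) :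
  psi (x + 1) - ln (M (x + theta) (x + sigma)) - r x @[x --> +oo] --> (0 : R).
Proof.
rewrite -[0](subr0 0); apply: cvgB => //.
pose c := Num.min theta sigma; pose C := Num.max theta sigma.
(* The squeeze rests on [ln (x + C) - ln x <= C / x], from the tangent at [x], and on [ln (x + 1) -
   ln (x + c) <= (1 - c) / (x + c)], from the tangent at [x + c]. Writing [x + 0] fits the shape of
   [cvgr_div_shift]. *)
have lower : - (C / (x + 0)) @[x --> +oo] --> (0 : R).
  by rewrite -oppr0; apply: cvgN; exact: cvgr_div_shift.
apply: (squeeze_cvgr _ lower (cvgr_div_shift (1 - c) c)).
near=> x.
have x1 : 1 < x by near: x; apply: nbhs_pinfty_gt; exact: num_real.
have xc : 0 < x + c.
  by rewrite -ltrBlDr; near: x; apply: nbhs_pinfty_gt; exact: num_real.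
have [ctheta csigma] : c <= theta /\ c <= sigma by rewrite !ge_min !lexx orbT.
have x0 : 0 < x by lra.
have xtheta : 0 < x + theta by lra.
have xsigma : 0 < x + sigma by lra.
have := M_mean (x + theta) (x + sigma).
rewrite !in_itv/= !andbT => /(_ xtheta xsigma).
rewrite -addr_minr -addr_maxr -/c -/C => /andP[cM MC].
have M0 := M_pos _ _ xtheta xsigma.
have xC : 0 < x + C := lt_le_trans M0 MC.
have /andP[psi_ge psi_le] := psiD1_bounds _ x1.
have x10 : 0 < x + 1 by lra.
have lnM_ge : ln (x + c) <= ln (M (x + theta) (x + sigma)) by rewrite ler_ln.
have lnM_le : ln (M (x + theta) (x + sigma)) <= ln (x + C) by rewrite ler_ln.
apply/andP; split.
  have := ln_le_tangent _ _ x0 xC.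
  rewrite addr0 mulrDl divff ?gt_eqF//; lra.
have := ln_le_tangent _ _ xc x10.
have -> : (x + 1) / (x + c) = 1 + (1 - c) / (x + c) by field; rewrite gt_eqF.
lra.
Unshelve. end_near. Qed.
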